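(* There is an algorithm that, given a connected block graph $G$, a vertex $v\in V(G)$ and an integer $k\ge 3$ (with $k\le n(G)$), computes ${\rm ecc}_k(v,G)$ in $O(k(n(G)+m(G)))$ time.
   Context: All graphs are finite, simple and undirected; $n(G)$ and $m(G)$ denote the number of vertices and edges of $G$. A block graph is a graph in which every block is a clique. For $S\subseteq V(G)$, a Steiner $S$-tree is a connected subgraph of $G$ containing all vertices of $S$ with minimum number of edges. The Steiner $k$-eccentricity of $v$ is ${\rm ecc}_k(v,G)=\max\{m(T): T \text{ is a Steiner } S\text{-tree},\ S\subseteq V(G),\ |S|=k,\ v\in S\}$. *)

(* Defs.v *)
From HB Require Import structures.
From mathcomp Require Import all_boot.

Set Implicit Arguments.
Unset Strict Implicit.
Unset Printing Implicit Defensive.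

(** * Graphs *)

(* A finite simple undirected graph whose vertices lie in the ambient type T;
   edges are two-element sets of vertices.  Subgraphs are again graphs on T. *)
Definition simple_graph (T : finType) (VE : {set T} * {set {set T}}) : bool :=
  [forall e in VE.2, (e \subset VE.1) && (#|e| == 2)].

Record graph (T : finType) : Type := Graph {
  graph_val : {set T} * {set {set T}};
  graph_simple : simple_graph graph_val
}.

HB.instance Definition _ (T : finType) := [isSub for @graph_val T].
HB.instance Definition _ (T : finType) := [Finite of graph T by <:].

Section GraphTheory.
Variable T : finType.
Implicit Types (G H B : graph T) (S : {set T}) (v x y z : T) (k : nat).

Definition vertices G : {set T} := (graph_val G).1.
Definition edges G : {set {set T}} := (graph_val G).2.
Definition nvertices G : nat := #|vertices G|.
Definition nedges G : nat := #|edges G|.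

Definition adj G : rel T := [rel x y | [set x; y] \in edges G].

(* Adjacency in G - x. *)
Definition adj_del G x : rel T :=
  [rel y z | [&& adj G y z, y != x & z != x]].

Definition connected G : bool :=
  (vertices G != set0) &&
  [forall x in vertices G, forall y in vertices G, connect (adj G) x y].

Definition complete G : bool :=
  [forall x in vertices G, forall y in vertices G, (x != y) ==> adj G x y].

Definition subgraph H G : bool :=
  (vertices H \subset vertices G) && (edges H \subset edges G).

(* x separates two other vertices of the same component. *)
Definition cut_vertex G x : bool :=
  (x \in vertices G) &&
  [exists y in vertices G :\ x, exists z in vertices G :\ x,
     connect (adj G) y z && ~~ connect (adj_del G x) y z].

Definition nonseparable G : bool :=
  connected G && [forall x, ~~ cut_vertex G x].

(* Maximal connected subgraph without a cut vertex of its own. *)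
Definition block G B : bool :=
  [&& subgraph B G, nonseparable B &
      [forall B' : graph T,
         [&& subgraph B B', subgraph B' G & nonseparable B'] ==> (B' == B)]].

Definition block_graph G : bool :=
  [forall B : graph T, block G B ==> complete B].

Definition connects G S H : bool :=
  [&& subgraph H G, connected H & S \subset vertices H].

Definition steiner_tree G S H : bool :=
  connects G S H &&
  [forall H' : graph T, connects G S H' ==> (nedges H <= nedges H')].

Definition steiner_ecc k v G : nat :=
  \max_(S : {set T} | [&& S \subset vertices G, #|S| == k & v \in S])
    \max_(H : graph T | steiner_tree G S H) nedges H.

End GraphTheory.

(** * Random access machine *)

(* Unit-cost RAM with addition and truncated subtraction only (no
   multiplication), in the style of Cook and Reckhow, with structured control
   flow.  A program mentions finitely many registers; the memory is addressed
   indirectly, through registers. *)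
Inductive instr : Type :=
| IConst (r c : nat)    (* r := c *)
| IAdd (r a b : nat)    (* r := a + b *)
| ISub (r a b : nat)    (* r := a - b *)
| ILoad (r a : nat)     (* r := mem[a] *)
| IStore (a b : nat).   (* mem[a] := b *)

Inductive prog : Type :=
| PSkip
| PInstr (i : instr)
| PSeq (p q : prog)
| PIf (r : nat) (p q : prog)
| PWhile (r : nat) (p : prog).

Record state : Type := State { regs : nat -> nat; mem : nat -> nat }.

Definition upd (f : nat -> nat) (a b : nat) : nat -> nat :=
  fun x => if x == a then b else f x.

Definition step (i : instr) (s : state) : state :=
  let: State R M := s in
  match i with
  | IConst r c => State (upd R r c) M
  | IAdd r a b => State (upd R r (R a + R b)) M
  | ISub r a b => State (upd R r (R a - R b)) M
  | ILoad r a => State (upd R r (M (R a))) M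
  | IStore a b => State R (upd M (R a) (R b))
  end.

(* [exec p s s' t]: started in s, the program p halts in s' after t steps;
   every instruction and every test of a register against 0 is one step. *)
Inductive exec : prog -> state -> state -> nat -> Prop :=
| ExecSkip s : exec PSkip s s 0
| ExecInstr i s : exec (PInstr i) s (step i s) 1
| ExecSeq p q s1 s2 s3 t1 t2 :
    exec p s1 s2 t1 -> exec q s2 s3 t2 -> exec (PSeq p q) s1 s3 (t1 + t2)
| ExecIfT r p q s s' t :
    regs s r != 0 -> exec p s s' t -> exec (PIf r p q) s s' t.+1
| ExecIfF r p q s s' t :
    regs s r = 0 -> exec q s s' t -> exec (PIf r p q) s s' t.+1
| ExecWhileT r p s1 s2 s3 t1 t2 :
    regs s1 r != 0 -> exec p s1 s2 t1 -> exec (PWhile r p) s2 s3 t2 ->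
    exec (PWhile r p) s1 s3 (t1 + t2).+1
| ExecWhileF r p s :
    regs s r = 0 -> exec (PWhile r p) s s 1.

Lemma exec_det p s s1 s2 t1 t2 :
  exec p s s1 t1 -> exec p s s2 t2 -> s1 = s2 /\ t1 = t2.
Proof.
move=> E1; elim: E1 s2 t2 => {p s s1 t1}.
- by move=> s s2 t2 E; inversion E.
- by move=> i s s2 t2 E; inversion E.
- move=> p q a b c t1 t1' _ IH1 _ IH2 s2 t2 E.
  inversion E as [| |? ? ? s' ? u u' E1 E2| | | |]; subst.
  by have [? ?] := IH1 _ _ E1; subst; have [-> ->] := IH2 _ _ E2.
- move=> r p q s s' t nz _ IH s2 t2 E.
  inversion E as [| | |? ? ? ? ? u _ E1|? ? ? ? ? u z E1| |]; subst.
    by have [-> ->] := IH _ _ E1.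
  by rewrite z in nz.
- move=> r p q s s' t z _ IH s2 t2 E.
  inversion E as [| | |? ? ? ? ? u nz E1|? ? ? ? ? u _ E1| |]; subst.
    by rewrite z in nz.
  by have [-> ->] := IH _ _ E1.
- move=> r p a b c t1 t1' nz _ IH1 _ IH2 s2 t2 E.
  inversion E as [| | | | |? ? ? s' ? u u' _ E1 E2|? ? ? z]; subst.
    by have [? ?] := IH1 _ _ E1; subst; have [-> ->] := IH2 _ _ E2.
  by rewrite z in nz.
- move=> r p s z s2 t2 E.
  inversion E as [| | | | |? ? ? s' ? u u' nz _ _|]; subst => //.
  by rewrite z in nz.
Qed.

(* The input words sit at addresses 0, 1, 2, ...; all else is 0. *)
Definition init (w : seq nat) : state := State (fun=> 0) (nth 0 w).

Definition output (s : state) : nat := regs s 0.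

(** * Adjacency-list representation *)

(* vs numbers the vertices, nbr u lists the neighbours of u, both in an
   arbitrary nvertices. *)
Definition adjacency_lists (T : finType) (G : graph T)
    (vs : seq T) (nbr : T -> seq T) : Prop :=
  [/\ uniq vs, vs =i vertices G &
      forall u, u \in vertices G -> uniq (nbr u) /\ nbr u =i adj G u].

(* n, k, the number of v, then n + 1 pointers, then the concatenated neighbour
   lists (as vertex numbers).  The pointers are absolute addresses: the list of
   vertex number i occupies the addresses from mem[3 + i] included to
   mem[4 + i] excluded. *)
Definition encode (T : finType) (vs : seq T) (nbr : T -> seq T)
    (v : T) (k : nat) : seq nat :=
  let n := size vs in
  let lists := [seq [seq index w vs | w <- nbr u] | u <- vs] in
  [:: n; k; index v vs]
  ++ [seq n + 4 + sumn (take i (shape lists)) | i <- iota 0 n.+1]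
  ++ flatten lists.

(* Main.v *)
Require Import Defs.
From mathcomp Require Import all_boot zify.

(* List the vertices by breadth-first search from v and call the first
   neighbour of x in this order its parent.  In a block graph every cycle spans
   a clique, so each edge joins a vertex to its parent or two vertices with the
   same parent.  Hence a connected subgraph containing v and s contains all
   ancestors of s, and a Steiner tree for a set S containing v has as many
   edges as there are ancestors of members of S other than v.  The maximum over
   S is reached greedily, by an exchange argument: mark v, then k - 1 times mark
   the ancestors of a vertex that has the most unmarked ancestors.  Each of the
   k - 1 rounds takes time O(n), and the search takes O(n + m). *)

Set Implicit Arguments.
Unset Strict Implicit.
Unset Printing Implicit Defensive.

(** * Cycles and blocks *)

(** [steiner_ecc] asks for sets of exactly k vertices, while greedy choices may repeat or be
    ancestors of one another. Padding bridges the gap, since adding vertices never shrinks a union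
    of ancestor sets. The size of a Steiner tree is bounded below because a connected graph on h
    vertices has at least h - 1 edges; joining every ancestor other than v to its parent attains the
    bound. On the machine, a mark overwrites the parent entry of a vertex. Nothing is lost, because
    the marked set is closed under ancestors: a climb stops at the first marked vertex, and a marked
    vertex has depth 0. Depth here means the number of unmarked ancestors. It changes from round to
    round and is recomputed in search order, where a parent comes before its children. A climb may
    be long, but all climbs together mark each vertex at most once, so they share one budget linear
    in n instead of being charged per round. *)

Lemma connect_crossing (T : finType) (e : rel T) (X : {set T}) x y :
  connect e x y -> x \in X -> y \notin X ->
  exists a b, [/\ a \in X, b \notin X & e a b].
Proof.
case/connectP=> p; elim: p x => [|z p IH] x /=.
  by move=> _ -> xX; rewrite xX.
case/andP=> exz pz y_last xX yX; case: (boolP (z \in X)) => zX.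
  exact: IH pz y_last zX yX.
by exists x, z.
Qed.

Section SimpleGraphs.
Variable T : finType.
Implicit Types (G H B : graph T) (S W : {set T}) (u v x y z : T).

Lemma edgeP G (e : {set T}) :
  e \in edges G -> e \subset vertices G /\ #|e| = 2.
Proof.
have /forall_inP/(_ e) := graph_simple G; rewrite /edges /vertices => h /h.
by case/andP=> -> /eqP.
Qed.

Lemma adj_sym G : symmetric (adj G).
Proof. by move=> x y; rewrite /adj /= setUC. Qed.

Lemma adj_del_sym G x : symmetric (adj_del G x).
Proof. by move=> y z; rewrite /adj_del /adj /= setUC [(y != x) && _]andbC. Qed.

Lemma adj_irr G x : adj G x x = false.
Proof. by apply/negP=> /edgeP[_]; rewrite setUid cards1. Qed.

Lemma adj_neq G x y : adj G x y -> x != y.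
Proof. by apply: contraTneq => ->; rewrite adj_irr. Qed.

Lemma adj_vertexl G x y : adj G x y -> x \in vertices G.
Proof. by case/edgeP=> /subsetP sub _; apply: sub; rewrite set21. Qed.

Lemma adj_vertexr G x y : adj G x y -> y \in vertices G.
Proof. by rewrite adj_sym; apply: adj_vertexl. Qed.

Lemma subgraph_refl G : subgraph G G.
Proof. by rewrite /subgraph !subxx. Qed.

Lemma subgraph_trans H G B : subgraph B H -> subgraph H G -> subgraph B G.
Proof.
by case/andP=> vB eB /andP[vH eH]; rewrite /subgraph (subset_trans vB) ?(subset_trans eB).
Qed.

Lemma subgraph_adj H G x y : subgraph H G -> adj H x y -> adj G x y.
Proof. by case/andP=> _ /subsetP; apply. Qed.

Lemma subgraph_eq H G :
  subgraph H G -> nvertices G + nedges G <= nvertices H + nedges H -> G = H.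
Proof.
case/andP=> sv se le; have cv := subset_leq_card sv; have ce := subset_leq_card se.
have /eqP ev : vertices H == vertices G.
  by rewrite eqEcard sv; move: cv ce le; rewrite /nvertices /nedges; lia.
have /eqP ee : edges H == edges G.
  by rewrite eqEcard se; move: cv ce le; rewrite /nvertices /nedges; lia.
apply: val_inj; rewrite /= [graph_val G]surjective_pairing [graph_val H]surjective_pairing.
by congr pair.
Qed.

Lemma induced_simple G W :
  simple_graph (W :&: vertices G, [set e in edges G | e \subset W]).
Proof.
apply/forall_inP=> e /=; rewrite inE => /andP[/edgeP[eG ->] eW].
by rewrite subsetI eW eG.
Qed.

Definition induced G W : graph T := Graph (induced_simple G W).

Lemma induced_subgraph G W : subgraph (induced G W) G.
Proof.
apply/andP; split; first exact: subsetIr.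
by apply/subsetP=> e; rewrite /edges /= inE => /andP[].
Qed.

Lemma adj_induced G W x y :
  adj (induced G W) x y = [&& adj G x y, x \in W & y \in W].
Proof. by rewrite /adj /edges /= inE subUset !sub1set. Qed.

(** Among the nonseparable subgraphs containing H, one with the largest total of vertices and edges
    is a block: a proper extension would have a larger total. *)
Lemma block_extension H G :
  subgraph H G -> nonseparable H -> exists2 B, block G B & subgraph H B.
Proof.
move=> HG nH; pose P B := [&& subgraph H B, subgraph B G & nonseparable B].
have PH : P H by rewrite /P subgraph_refl HG.
case: (@arg_maxnP _ H P (fun B => nvertices B + nedges B) PH) => B /and3P[HB BG nB] maxB.
exists B => //; apply/and3P; split=> //; apply/forallP=> B'; apply/implyP.
case/and3P=> BB' B'G nB'; apply/eqP; apply: (subgraph_eq BB').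
by apply: maxB; rewrite /P (subgraph_trans HB BB') B'G.
Qed.

Lemma path_all_connect (e : rel T) x p :
  symmetric e -> path e x p -> {in x :: p &, forall y z, connect e y z}.
Proof.
move=> es /path_connect pc y z yp zp.
by apply: connect_trans (pc z zp); rewrite sym_connect_sym //; apply: pc.
Qed.

(** Rotating the cycle to start at x turns it into x followed by a path. The path survives the
    deletion of x and connects all remaining vertices; chords do no harm. *)
Lemma cycle_nonseparable G (c : seq T) :
  c != [::] -> {subset c <= vertices G} -> uniq c -> cycle (adj G) c ->
  nonseparable (induced G [set x in c]).
Proof.
set H := induced _ _ => nc cG uc cc.
have memH z : (z \in vertices H) = (z \in c).
  by rewrite /vertices /= !inE; case: (boolP (z \in c)) => // /cG.
have path_from x : x \in c -> exists p,
    [/\ path (adj G) x p, uniq (x :: p) & c =i x :: p].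
  case/rot_to=> i p cE; exists p; split; last by move=> z; rewrite -cE mem_rot.
    by move: cc; rewrite -(rot_cycle i) cE /= rcons_path => /andP[].
  by rewrite -cE rot_uniq.
apply/andP; split; last apply/forallP=> x.
  have [x xc] : exists x, x \in c by case: c nc {H cG uc cc memH path_from} => // x c; exists x; rewrite mem_head.
  apply/andP; split; first by apply/set0Pn; exists x; rewrite memH.
  have [p [xp _ cE]] := path_from x xc.
  apply/forall_inP=> y; rewrite memH cE => yp; apply/forall_inP=> z; rewrite memH cE => zp.
  apply: path_all_connect yp zp; first exact: adj_sym.
  apply: (sub_in_path (P := [in c])) xp; last by apply/allP=> w; rewrite cE.
  by move=> a b ac bc ab; rewrite adj_induced ab !inE ac.
rewrite /cut_vertex memH; apply/andP=> -[/path_from[p [xp up cE]]].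
case/exists_inP=> y; rewrite in_setD1 memH cE inE => /andP[yx]; rewrite (negPf yx) /= => yp.
case/exists_inP=> z; rewrite in_setD1 memH cE inE => /andP[zx]; rewrite (negPf zx) /= => zp.
case/andP=> _ /negP[]; case: p xp up cE yp zp => // w p /= /andP[_ wp] /andP[xp _] cE yp zp.
apply: path_all_connect yp zp; first exact: adj_del_sym.
apply: (sub_in_path (P := [in w :: p])) wp; last by apply/allP=> a.
move=> a b ap bp ab; rewrite /adj_del /= adj_induced ab !inE !cE ![_ \in x :: _]inE ap bp !orbT /=.
by apply/andP; split; [apply: contraNneq xp => <-|apply: contraNneq xp => <-].
Qed.

Lemma block_graph_cycle G (c : seq T) :
  block_graph G -> {subset c <= vertices G} -> uniq c -> cycle (adj G) c ->
  {in c &, forall x y, x != y -> adj G x y}.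
Proof.
move=> bG cG uc cc x y xc yc neq.
have nc : c != [::] by case: c xc {cG uc cc yc}.
have [B bB HB] := block_extension (induced_subgraph _ _) (cycle_nonseparable nc cG uc cc).
have /and3P[BG _ _] := bB; apply: (subgraph_adj BG).
have cB z : z \in c -> z \in vertices B.
  by move=> zc; case/andP: HB => /subsetP sub _; apply: sub; rewrite /vertices /= !inE zc cG.
have /forallP/(_ B)/implyP/(_ bB) := bG.
by move=> /forall_inP/(_ x (cB _ xc))/forall_inP/(_ y (cB _ yc))/implyP; apply.
Qed.

(** A vertex set grown from v takes in one new vertex at a time along an edge that crosses its
    border, and each such edge is new inside the set. *)
Lemma connected_leq_edges H : connected H -> nvertices H <= (nedges H).+1.
Proof.
case/andP=> /set0Pn[v vH] /forall_inP cH.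
suff grow m : m < nvertices H -> exists W : {set T},
    [/\ v \in W, W \subset vertices H, #|W| = m.+1 &
        m <= #|[set e in edges H | e \subset W]|].
  case E: (nvertices H) => [|m] //; have [|W [_ _ _ leW]] := grow m; first by rewrite E.
  by rewrite ltnS (leq_trans leW) // subset_leq_card //; apply/subsetP=> e; rewrite inE => /andP[].
elim: m => [|m IH] lt; first by exists [set v]; rewrite set11 sub1set vH cards1.
have [|W [vW WH cW eW]] := IH; first exact: ltnW.
have [y yH yW] : exists2 y, y \in vertices H & y \notin W.
  apply/subsetPn; apply: contraTN lt => /subset_leq_card.
  by rewrite cW -leqNgt.
have [a [b [aW bW ab]]] := connect_crossing (forall_inP (cH v vH) y yH) vW yW.
exists (b |: W); rewrite setU1r // subUset sub1set (adj_vertexr ab) WH cardsU1 bW cW.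
split=> //; apply: leq_trans (_ : (m < #|[set a; b] |: [set e in edges H | e \subset W]|) ) _.
  by rewrite cardsU1 !inE subUset !sub1set (negPf bW) !andbF.
apply/subset_leq_card/subsetP=> e /setU1P[->|].
  by rewrite inE; apply/andP; split=> //; rewrite subUset !sub1set !inE aW eqxx orbT.
by rewrite !inE => /andP[-> /subset_trans-> //]; apply: subsetUr.
Qed.

(** Double counting of incident pairs: w corresponds to the edge [[set u; w]]. This makes the cost
    of scanning all neighbour lists linear in m. *)
Lemma sum_degrees G (nbr : T -> seq T) :
  (forall u, u \in vertices G -> uniq (nbr u) /\ nbr u =i adj G u) ->
  \sum_(u in vertices G) size (nbr u) = (nedges G).*2.
Proof.
move=> nbrP; transitivity (\sum_(u in vertices G) \sum_(e in edges G) (u \in e)).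
  apply: eq_bigr => u uG; have [un nE] := nbrP u uG.
  have -> : \sum_(e in edges G) (u \in e) = #|[set e in edges G | u \in e]|.
    by rewrite -sum1dep_card [RHS]big_mkcondr; apply: eq_bigr => e _; case: (u \in e).
  have inj : {in nbr u &, injective (fun w => [set u; w])}.
    move=> a b; rewrite !nE => ua _ /setP/(_ a); rewrite !inE eqxx orbT => /esym/orP[]/eqP // au.
    by have /adj_neq := (ua : adj G u a); rewrite au eqxx.
  rewrite -(card_uniqP un) -(card_in_imset inj).
  apply: eq_card => e; rewrite inE; apply/imsetP/andP.
    by case=> w; rewrite nE => uw ->; rewrite set21.
  case=> eG ue; have [_ /eqP/cards2P[a [b [ab eE]]]] := edgeP eG.
  have [w ew] : exists w, e = [set u; w].
    move: ue; rewrite eE !inE => /orP[]/eqP->; first by exists b.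
    by exists a; rewrite setUC.
  by exists w; rewrite // nE unfold_in /adj /= -ew.
rewrite exchange_big /= -muln2 -sum_nat_const; apply: eq_bigr => e /edgeP[eG <-].
rewrite -sum1_card [RHS]big_mkcond [LHS]big_mkcond; apply: eq_bigr => u _.
by case: (boolP (u \in e)) => [/(subsetP eG)->|_] //; rewrite if_same.
Qed.

End SimpleGraphs.

(** * Greedy choice and search trees *)

Section Greedy.
Variables (T : finType) (U : T -> {set T}).
Implicit Types (A S : {set T}) (x s : T).

Definition hull S := \bigcup_(s in S) U s.

(** The member s of S given up for x is one whose [U s] meets [U x] in the largest set. By
    nestedness, [U s] then contains everything that any member of S shares with [U x]. So an element
    of the hull outside [U s] comes from another member and avoids [U x], while [U s] itself adds at
    most as much to A as [U x] does. *)
Lemma greedy_exchange A S x j :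
  (forall s s', U x :&: U s \subset U s' \/ U x :&: U s' \subset U s) ->
  {in S, forall s, #|U s :\: A| <= #|U x :\: A|} -> #|S| <= j.+1 ->
  exists S', [/\ S' \subset S, #|S'| <= j &
    #|hull S :\: A| <= #|U x :\: A| + #|hull S' :\: (A :|: U x)|].
Proof.
move=> nested maxx; have [-> _|/set0Pn[s0 s0S]] := eqVneq S set0.
  by exists set0; rewrite /hull big_set0 cards0 set0D cards0.
case: (@arg_maxnP _ s0 [in S] (fun s => #|U x :&: U s|) s0S) => s sS maxs cS.
have meet s' : s' \in S -> U x :&: U s' \subset U s.
  move=> s'S; case: (nested s s') => // sub.
  have /eqP <- : U x :&: U s == U x :&: U s' by rewrite eqEcard subsetI subsetIl sub; apply: maxs.
  exact: subsetIr.
exists (S :\ s); split; first exact: subsetDl.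
  by move: cS; rewrite (cardsD1 s) sS.
apply: leq_trans (leq_add (maxx s sS) (leqnn _)); rewrite addnC.
rewrite (leq_trans _ (leq_card_setU _ _)) // subset_leq_card //.
apply/subsetP=> y; rewrite !inE => /andP[yA /bigcupP[t tS yt]]; rewrite (negPf yA) /=.
case: (boolP (y \in U s)) => [|ys]; rewrite ?orbT // orbF.
apply/andP; split.
  by apply: contra ys => yx; apply: (subsetP (meet t tS)); rewrite inE yx.
by apply/bigcupP; exists t; rewrite // !inE tS andbT; apply: contraNneq ys => <-.
Qed.

End Greedy.

Lemma subset_card_extension (T : finType) (A V : {set T}) m :
  A \subset V -> #|A| <= m <= #|V| ->
  exists B : {set T}, [/\ A \subset B, B \subset V & #|B| = m].
Proof.
move=> AV /andP[]; elim: m => [|m IH].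
  by rewrite leqn0 cards_eq0 => /eqP-> _; exists set0; rewrite !sub0set cards0.
rewrite leq_eqVlt => /orP[/eqP cA _|Am mV]; first by exists A.
have [B [AB BV cB]] := IH Am (ltnW mV).
have /subsetPn[y yV yB] : ~~ (V \subset B).
  by apply: contraTN mV => /subset_leq_card; rewrite cB -leqNgt.
exists (y |: B); rewrite cardsU1 yB cB subUset sub1set yV BV.
by rewrite (subset_trans AB) ?subsetUr.
Qed.

Lemma path_all_target (T : Type) (e : rel T) (P : pred T) x p :
  (forall y z, e y z -> P z) -> path e x p -> all P p.
Proof.
by move=> eP; elim: p x => //= y p IH x /andP[/eP-> /IH].
Qed.

(** * Parents and ancestors with respect to a search order *)

Section SearchTree.
Variables (T : finType) (G : graph T) (v : T).
Implicit Types (q : seq T) (S : {set T}) (x y z : T).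

Definition first_nbr q x := nth v q (find (adj G ^~ x) q).

(** The root is its own parent, so iterating [parent] is total and ancestor sets are orbits of a
    function; v is a fixed point. *)
Definition parent q x := if x == v then v else first_nbr q x.

(** Only an earlier neighbour is demanded of each later vertex. The breadth-first discipline matters
    for the program, where it makes the vertex that discovers y the first neighbour of y. *)
Definition search_order q : Prop :=
  [/\ uniq q, q =i vertices G, nth v q 0 = v &
      forall i, 0 < i < size q -> has (adj G ^~ (nth v q i)) (take i q)].

Definition ancestors q x : {set T} := [set y | fconnect (parent q) x y].

Variable q : seq T.
Hypothesis so : search_order q.
Local Notation V := (vertices G).
Local Notation par := (parent q).
Local Notation U := (ancestors q).
Local Notation idx x := (index x q).

Lemma idx_root : v \in V -> idx v = 0.
Proof.
case: so => uq qV q0 _ vV; rewrite -{1}q0 index_uniq //.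
by rewrite -has_predT; apply/hasP; exists v => //; rewrite qV.
Qed.

Lemma parent_root : par v = v.
Proof. by rewrite /parent eqxx. Qed.

Lemma parentP x : x \in V -> x != v ->
  [/\ adj G (par x) x, idx (par x) < idx x &
      forall z, adj G z x -> idx (par x) <= idx z].
Proof.
case: so => uq qV q0 early xV xv; have xq : x \in q by rewrite qV.
rewrite /parent (negPf xv) /first_nbr; set f := find _ _.
have i0 : 0 < idx x < size q.
  rewrite index_mem xq andbT lt0n; apply: contraNneq xv => i0.
  by rewrite -q0 -i0 nth_index.
have := early _ i0; rewrite nth_index // => has_early.
have ltf : f < idx x.
  have -> : f = find (adj G ^~ x) (take (idx x) q ++ drop (idx x) q) by rewrite cat_take_drop.
  rewrite find_cat has_early; move: has_early.
  by rewrite has_find => /leq_trans; apply; rewrite size_take_min geq_minl.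
have fq : f < size q by apply: leq_trans ltf (index_size _ _).
rewrite index_uniq //; split=> //; first by apply: (@nth_find _ v (adj G ^~ x)); rewrite has_find.
move=> z zx; rewrite leqNgt; apply/negP=> /(before_find v).
by rewrite nth_index ?zx // qV (adj_vertexl zx).
Qed.

Lemma ancestors_refl x : x \in U x.
Proof. by rewrite inE connect0. Qed.

Lemma ancestors_step x : U x = x |: U (par x).
Proof.
apply/setP=> y; rewrite !inE; apply/idP/orP; last first.
  case=> [/eqP->|]; first exact: connect0.
  by apply: connect_trans; apply: fconnect1.
case/connectP=> -[_ ->|z p /= /andP[/eqP <- zp ->]]; [left|right] => //.
by apply/connectP; exists p.
Qed.

Lemma ancestors_trans x y : y \in U x -> U y \subset U x.
Proof.
by rewrite inE => xy; apply/subsetP=> z; rewrite !inE; apply: connect_trans.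
Qed.

Lemma ancestors_root : U v = [set v].
Proof.
apply/setP=> y; rewrite !inE; apply/idP/eqP=> [/iter_findex <-|->]; last exact: connect0.
by rewrite iter_fix // parent_root.
Qed.

Lemma ancestors_chain x y z : y \in U x -> z \in U x -> z \in U y \/ y \in U z.
Proof.
rewrite !inE => /iter_findex <- /iter_findex <-.
move: (findex _ _ y) (findex _ _ z) => i j.
case: (leqP i j) => [/subnK <-|/ltnW/subnK <-]; rewrite iterD; [left|right]; exact: fconnect_iter.
Qed.

(** The ancestors of x form a chain. If y is common to x and s but not an ancestor of s', then any z
    common to x and s' is comparable with y and cannot lie below it; hence z is an ancestor of y,
    and so of s. *)
Lemma ancestors_nested x s s' :
  U x :&: U s \subset U s' \/ U x :&: U s' \subset U s.
Proof.
case: (boolP (U x :&: U s \subset U s')) => [|/subsetPn[y]]; first by left.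
rewrite inE => /andP[yx ys] ys'; right; apply/subsetP=> z; rewrite inE => /andP[zx zs'].
case: (ancestors_chain yx zx) => [/(subsetP (ancestors_trans ys))|] // /(subsetP (ancestors_trans zs')).
by rewrite (negPf ys').
Qed.

Hypothesis vV : v \in V.

Lemma idx_ind (P : T -> Prop) :
  P v -> (forall x, x \in V -> x != v -> P (par x) -> P x) ->
  forall x, x \in V -> P x.
Proof.
move=> Pv Pstep x; have [n] := ubnP (idx x); elim: n x => // n IH x ltn xV.
have [->|xv] := eqVneq x v; first by [].
have [/adj_vertexl pV lt _] := parentP xV xv.
by apply: Pstep => //; apply: IH => //; apply: leq_trans lt _.
Qed.

Lemma ancestors_sub x : x \in V -> U x \subset V.
Proof.
move: x; apply: idx_ind; first by rewrite ancestors_root sub1set.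
by move=> x xV _ sub; rewrite ancestors_step subUset sub1set xV.
Qed.

Lemma ancestors_idx x : x \in V -> {in U x, forall y, idx y <= idx x}.
Proof.
move: x; apply: idx_ind; first by move=> y; rewrite ancestors_root => /set1P->.
move=> x xV xv IH y; rewrite ancestors_step => /setU1P[->//|/IH].
by have [_ /ltnW lt _] := parentP xV xv => /leq_trans; apply.
Qed.

Lemma notin_ancestors_parent x : x \in V -> x != v -> x \notin U (par x).
Proof.
move=> xV xv; have [/adj_vertexl pV lt _] := parentP xV xv.
by apply/negP=> /(ancestors_idx pV); rewrite leqNgt lt.
Qed.

Lemma ancestors_connect (e : rel T) x :
  x \in V -> (forall y, y \in U x -> y != v -> e y (par y)) -> connect e x v.
Proof.
move: x; apply: idx_ind => [_|x xV xv IH esub]; first exact: connect0.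
apply: connect_trans (connect1 (esub x (ancestors_refl x) xv)) (IH _) => y yx.
by apply: esub; rewrite ancestors_step inE yx orbT.
Qed.

(** * Steiner trees in block graphs as unions of ancestor sets *)

Section BlockGraph.
Hypothesis bG : block_graph G.

(* If a comes before b in the order, par a and par b are joined by a path
   through vertices preceding a, which a and b close into a cycle; the cycle is
   a clique and parents are first neighbours, so par a = par b. *)
Lemma edge_parent_lt a b :
  adj G a b -> idx a < idx b -> par b = a \/ par b = par a.
Proof.
move=> ab lt_ab; have [aV bV] := (adj_vertexl ab, adj_vertexr ab).
have bv : b != v by apply: contraTneq lt_ab => ->; rewrite idx_root.
have [pb_b lt_pb minb] := parentP bV bv.
have [eav|av] := eqVneq a v.
  left; rewrite eav; have := minb a ab; rewrite eav idx_root // leqn0 => /eqP pb0.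
  have [_ qV q0 _] := so.
  by rewrite -[RHS]q0 -pb0 nth_index ?qV ?(adj_vertexl pb_b).
have [pa_a lt_pa mina] := parentP aV av.
have [pa_eq|pa_neq] := eqVneq (par b) a; [by left | right].
have [_ qV _ _] := so.
have idx_inj x y : x \in V -> y \in V -> idx x = idx y -> x = y.
  by rewrite -!qV => xq yq eq_i; rewrite -(nth_index v xq) eq_i nth_index.
have [paV pbV] := (adj_vertexl pa_a, adj_vertexl pb_b).
have lt_pba : idx (par b) < idx a.
  rewrite ltn_neqAle minb // andbT; apply: contraNneq pa_neq => eq_i.
  by apply/eqP; apply: idx_inj eq_i.
pose e := [rel x y | [&& adj G x y, idx x < idx a & idx y < idx a]].
have es : symmetric e by move=> x y; rewrite /e /adj /= setUC [(idx x < _) && _]andbC.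
have to_root x : x \in V -> idx x < idx a -> connect e x v.
  move=> xV lt; apply: ancestors_connect => // y yx yv.
  have yV := subsetP (ancestors_sub xV) y yx.
  have [py lty _] := parentP yV yv; have lt_y := leq_ltn_trans (ancestors_idx xV yx) lt.
  by rewrite /e /= -/(adj G y (par y)) adj_sym py lt_y (ltn_trans lty).
have : connect e (par a) (par b).
  by apply: connect_trans (to_root _ paV lt_pa) _; rewrite sym_connect_sym // to_root.
case/connectP=> p0 /shortenP[p ep up _] last_p.
have pG : {subset par a :: p <= V} /\ {in par a :: p, forall x, idx x < idx a}.
  have small : {in par a :: p, forall x, x \in V /\ idx x < idx a}.
    move=> x; rewrite inE => /orP[/eqP->//|xp].
    have eQ y z : e y z -> (z \in V) && (idx z < idx a).
      by case/and3P=> /adj_vertexr-> _ ->.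
    by have /allP/(_ x xp)/andP := path_all_target eQ ep.
  by split=> x /small[].
pose c := a :: rcons (par a :: p) b.
have cc : cycle (adj G) c.
  rewrite /c /= !rcons_path /= -last_p adj_sym pa_a pb_b last_rcons adj_sym ab !andbT /=.
  by apply: sub_path ep => x y /and3P[].
have uc : uniq c.
  rewrite /c cons_uniq rcons_uniq up mem_rcons inE negb_or !andbT.
  have [_ small] := pG.
  have -> : a != b by apply: contraTneq lt_ab => ->; rewrite ltnn.
  apply/andP; split; apply/negP=> /small; first by rewrite ltnn.
  by rewrite ltnNge (ltnW lt_ab).
have cG : {subset c <= V}.
  by move=> x; rewrite inE mem_rcons inE => /or3P[/eqP->|/eqP->|/(proj1 pG)].
have clique := block_graph_cycle bG cG uc cc.
have pac : par a \in c by rewrite /c !inE eqxx orbT.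
have pbc : par b \in c by rewrite /c inE mem_rcons inE last_p mem_last !orbT.
have [ac bc] : a \in c /\ b \in c by rewrite /c !inE !mem_rcons !inE !eqxx !orbT.
have bpa : par a != b by apply: contraTneq lt_pa => ->; rewrite -leqNgt ltnW.
apply: idx_inj => //; apply/eqP; rewrite eqn_leq minb ?mina //; apply: clique => //.
Qed.

Lemma edge_parent a b :
  adj G a b -> [\/ par b = a, par a = b | par a = par b].
Proof.
move=> ab; have [aV bV] := (adj_vertexl ab, adj_vertexr ab).
have ba : adj G b a by rewrite adj_sym.
case: (ltngtP (idx a) (idx b)) => [lt|lt|].
- by case: (edge_parent_lt ab lt) => ->; [constructor 1|constructor 3].
- by case: (edge_parent_lt ba lt) => ->; [constructor 2|constructor 3].
have [_ qV _ _] := so => eq_i; have := adj_neq ab.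
by rewrite -(@nth_index _ v a q) ?qV // eq_i nth_index ?qV // eqxx.
Qed.

(** If an ancestor y of s were missing from H, some edge of H would leave the set of vertices that
    have y as an ancestor. By [edge_parent] its ends are parent and child or siblings, and since
    neither end is y, both or none of them have y as an ancestor. *)
Lemma ancestors_sub_connected H s :
  subgraph H G -> connected H -> v \in vertices H -> s \in vertices H ->
  U s \subset vertices H.
Proof.
move=> HG /andP[_ /forall_inP cH] vH sH; apply/subsetP=> y ys; apply/negPn/negP=> yH.
have vy : v \notin [set x | y \in U x].
  by rewrite inE ancestors_root inE; apply: contraNneq yH => ->.
have sy : s \in [set x | y \in U x] by rewrite inE.
have [a [b []]] := connect_crossing (forall_inP (cH s sH) v vH) sy vy.
rewrite 2!in_set => ya /negP yb ab; apply: yb.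
have yNa : y != a by apply: contraNneq yH => ->; apply: adj_vertexl ab.
move: ya; case: (edge_parent (subgraph_adj HG ab)) => [eb|<-|eab].
- by move=> ya; rewrite ancestors_step eb in_setU1 ya orbT.
- by rewrite {1}ancestors_step in_setU1 (negPf yNa).
rewrite ancestors_step in_setU1 (negPf yNa) /= eab => yp.
by rewrite ancestors_step in_setU1 yp orbT.
Qed.

Lemma hull_root S : v \in S -> v \in hull U S.
Proof. by move=> vS; apply/bigcupP; exists v => //; apply: ancestors_refl. Qed.

Lemma hull_ancestors S x : x \in hull U S -> U x \subset hull U S.
Proof.
case/bigcupP=> s sS xs; apply: subset_trans (ancestors_trans xs) _.
exact: (bigcup_sup s).
Qed.

Lemma hull_sub S : S \subset V -> hull U S \subset V.
Proof.
by move=> /subsetP SV; apply/bigcupsP=> s /SV; apply: ancestors_sub.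
Qed.

Definition hull_edges S := [set [set x; par x] | x in hull U S :\ v].

(** Intersecting with the vertex set and filtering the edges yields a simple graph for every S
    without hypotheses; for S inside the vertex set nothing is removed. *)
Lemma hull_simple S :
  simple_graph (hull U S :&: V, [set e in hull_edges S | (e \subset hull U S :&: V) && (#|e| == 2)]).
Proof. by apply/forall_inP=> e /=; rewrite inE => /andP[]. Qed.

Definition hull_tree S : graph T := Graph (hull_simple S).

Lemma hull_tree_connects S : v \in S -> S \subset V -> connects G S (hull_tree S).
Proof.
move=> vS SV; have hV := hull_sub SV.
have edge x : x \in hull U S -> x != v -> adj (hull_tree S) x (par x).
  move=> xh xv; have xV := subsetP hV x xh; have [px _ _] := parentP xV xv.
  have ph : par x \in hull U S.
    by apply: (subsetP (hull_ancestors xh)); rewrite ancestors_step inE ancestors_refl orbT.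
  rewrite /adj /edges /= inE subUset !sub1set !in_setI xh xV ph (adj_vertexl px).
  rewrite cards2 [x == _]eq_sym (adj_neq px).
  by rewrite !andbT; apply/imsetP; exists x; rewrite // in_setD1 xv xh.
apply/and3P; split.
- apply/andP; split; first exact: subsetIr.
  apply/subsetP=> e; rewrite /edges /= inE => /and3P[/imsetP[x]].
  rewrite in_setD1 => /andP[xv xh] -> _ _.
  by have [px _ _] := parentP (subsetP hV x xh) xv; rewrite setUC.
- apply/andP; split; first by apply/set0Pn; exists v; rewrite inE hull_root.
  have to_root x : x \in hull U S -> connect (adj (hull_tree S)) x v.
    move=> xh; apply: ancestors_connect; first exact: (subsetP hV).
    by move=> y /(subsetP (hull_ancestors xh)); apply: edge.
  apply/forall_inP=> x /setIP[xh _]; apply/forall_inP=> y /setIP[yh _].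
  apply: connect_trans (to_root x xh) _; rewrite sym_connect_sym ?to_root //.
  exact: adj_sym.
apply/subsetP=> x xS; rewrite inE (subsetP SV) // andbT.
by apply/bigcupP; exists x => //; apply: ancestors_refl.
Qed.

Lemma hull_tree_edges S : v \in S -> nedges (hull_tree S) <= #|hull U S|.-1.
Proof.
move=> vS; apply: leq_trans (_ : #|hull_edges S| <= _).
  by apply/subset_leq_card/subsetP=> e; rewrite inE => /andP[].
by rewrite [#|hull U S|](cardsD1 v) hull_root //= leq_imset_card.
Qed.

Lemma connects_leq S H :
  v \in S -> connects G S H -> #|hull U S|.-1 <= nedges H.
Proof.
move=> vS /and3P[HG cH /subsetP SH]; rewrite -subn1 leq_subLR add1n.
apply: leq_trans (connected_leq_edges cH); apply/subset_leq_card/bigcupsP=> s sS.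
by apply: ancestors_sub_connected => //; apply: SH.
Qed.

Lemma steiner_max S : v \in S -> S \subset V ->
  \max_(H : graph T | steiner_tree G S H) nedges H = #|hull U S|.-1.
Proof.
move=> vS SV; have ct := hull_tree_connects vS SV; have le := hull_tree_edges vS.
apply/eqP; rewrite eqn_leq; apply/andP; split.
  apply/bigmax_leqP=> H /andP[_ /forallP/(_ (hull_tree S))/implyP/(_ ct) leH].
  exact: leq_trans leH le.
apply: leq_trans (connects_leq vS ct) _.
rewrite (bigD1 (hull_tree S)) /= ?leq_maxl // /steiner_tree ct /=.
apply/forallP=> H; apply/implyP=> cH.
exact: leq_trans le (connects_leq vS cH).
Qed.

(** The form in which the greedy loop delivers its result: K bounds the number of chosen vertices
    apart from v, X is the greedy choice, and both hypotheses count ancestors other than v. *)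
Lemma steiner_ecc_hull K m :
  K < nvertices G ->
  (exists X : {set T}, [/\ X \subset V, #|X| <= K & #|v |: hull U X| = m.+1]) ->
  (forall S, S \subset V -> #|S| <= K -> #|hull U S :\ v| <= m) ->
  steiner_ecc K.+1 v G = m.
Proof.
move=> KV [X [XV cX hX]] ub; apply/eqP; rewrite eqn_leq; apply/andP; split.
  apply/bigmax_leqP=> S /and3P[SV /eqP cS vS]; rewrite steiner_max //.
  move: cS; rewrite (cardsD1 v) vS add1n => -[cS].
  rewrite (cardsD1 v) hull_root //=; apply: leq_trans (ub (S :\ v) _ _); last by rewrite cS.
    apply/subset_leq_card/subsetP=> x; rewrite !inE => /andP[xv /bigcupP[s sS xs]].
    rewrite xv; apply/bigcupP; exists s => //; rewrite !inE sS andbT.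
    by apply: contraNneq xv => sv; move: xs; rewrite sv ancestors_root inE.
  exact: subset_trans (subsetDl _ _) SV.
have vXV : v |: X \subset V by rewrite subUset sub1set vV.
(* X may have fewer than K elements or contain v; padding to exactly K + 1 vertices can only enlarge
   the hull. *)
have [|S [vXS SV cS]] := subset_card_extension (m := K.+1) vXV.
  by rewrite KV andbT cardsU1; case: (v \notin X) => //; rewrite ltnW.
have vS : v \in S by apply: (subsetP vXS); rewrite setU11.
have PS : [&& S \subset V, #|S| == K.+1 & v \in S] by rewrite SV cS vS eqxx.
rewrite /steiner_ecc (bigD1 S PS) /= leq_max steiner_max //; apply/orP; left.
rewrite -ltnS -hX (leq_trans _ (leqSpred _)) // subset_leq_card // subUset sub1set hull_root //=.
apply/bigcupsP=> x xX; apply: (bigcup_sup x); apply: (subsetP vXS).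
by rewrite inE xX orbT.
Qed.

End BlockGraph.
End SearchTree.

(** * Time credits *)

Section TimedWP.
Implicit Types (p : prog) (s : state) (c : nat) (Q : state -> nat -> Prop).

(* c is a budget of time credits; Q receives the credits left over *)
Definition wp p Q s c := exists s' t, [/\ exec p s s' t, t <= c & Q s' (c - t)].

Definition block_of (l : seq instr) := foldr (fun i => PSeq (PInstr i)) PSkip l.

Lemma wp_block l Q s c :
  size l <= c -> Q (foldl (fun s i => step i s) s l) (c - size l) ->
  wp (block_of l) Q s c.
Proof.
elim: l s c => [|i l IH] s c /=; first by exists s, 0; split=> //; constructor.
move=> lc Qc; have [||s' [t [E tc Qt]]] := IH (step i s) c.-1; first by lia.
  by have -> : c.-1 - size l = c - (size l).+1 by lia.
exists s', (1 + t); split; first by econstructor; [constructor|].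
  by lia.
by have -> : c - (1 + t) = c.-1 - t by lia.
Qed.

Lemma wp_seq p q Q s c : wp p (wp q Q) s c -> wp (PSeq p q) Q s c.
Proof.
case=> s1 [t1 [E1 t1c [s2 [t2 [E2 t2c Q2]]]]]; exists s2, (t1 + t2).
split; [exact: ExecSeq E1 E2|lia|by rewrite subnDA].
Qed.

Lemma wp_if r p q Q s c : 0 < c ->
  (regs s r != 0 -> wp p Q s c.-1) -> (regs s r = 0 -> wp q Q s c.-1) ->
  wp (PIf r p q) Q s c.
Proof.
move=> c0 wt wf; have [r0|rn0] := eqVneq (regs s r) 0.
  have [s' [t [E tc Qt]]] := wf r0; exists s', t.+1.
  by split; [exact: ExecIfF|lia|have -> : c - t.+1 = c.-1 - t by lia].
have [s' [t [E tc Qt]]] := wt rn0; exists s', t.+1.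
by split; [exact: ExecIfT|lia|have -> : c - t.+1 = c.-1 - t by lia].
Qed.

Lemma wp_conseq p Q Q' s c :
  wp p Q s c -> (forall s' c', Q s' c' -> Q' s' c') -> wp p Q' s c.
Proof. by case=> s' [t [E tc /[swap]/[apply] Q't]]; exists s', t. Qed.

Lemma wp_seq_mid (Qmid : state -> nat -> Prop) p q Q s c :
  wp p Qmid s c -> (forall s' c', Qmid s' c' -> wp q Q s' c') ->
  wp (PSeq p q) Q s c.
Proof. by move=> wp_p wp_q; apply/wp_seq/(wp_conseq wp_p). Qed.

(* Each iteration pays for its test, so that termination follows from the
   credits and no separate variant is needed. *)
Lemma wp_while (Inv : state -> nat -> Prop) r p Q s c :
  Inv s c -> (forall s c, Inv s c -> 0 < c) ->
  (forall s c, Inv s c -> regs s r != 0 -> wp p Inv s c.-1) ->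
  (forall s c, Inv s c -> regs s r = 0 -> Q s c.-1) ->
  wp (PWhile r p) Q s c.
Proof.
move=> + Ipos Istep Iend; have [m] := ubnP c; elim: m s c => // m IH s c cm Isc.
have c0 := Ipos s c Isc; have [r0|rn0] := eqVneq (regs s r) 0.
  exists s, 1; split=> //; first exact: ExecWhileF.
  by rewrite subn1; apply: Iend.
have [s1 [t1 [E1 t1c I1]]] := Istep s c Isc rn0.
have [|s2 [t2 [E2 t2c Q2]]] := IH s1 (c.-1 - t1) _ I1; first by lia.
exists s2, (t1 + t2).+1; split; [exact: ExecWhileT E1 E2|lia|].
by have -> : c - (t1 + t2).+1 = c.-1 - t1 - t2 by lia.
Qed.

End TimedWP.

Arguments block_of : simpl never.

(** * Register updates and the program text *)

Lemma upd_eq (f : nat -> nat) a b : upd f a b a = b.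
Proof. by rewrite /upd eqxx. Qed.

Lemma upd_neq (f : nat -> nat) a b x : x <> a -> upd f a b x = f x.
Proof. by move=> /eqP/negPf xa; rewrite /upd xa. Qed.

(* Registers: 0 result, 1 n, 2 k and then the rounds left, 3 the constant 1,
   4 the address of the list pointers, 5 the end b of the input, 6 and 7 the
   addresses b + n and b + 2n of the parents and of the depths, 8 position in
   the order, 9 length of the order, 14 the constant 0 after the search, 16 and
   17 largest depth and its vertex, 18 the number of v. *)
Definition scan_neighbours : prog :=
  PWhile 14
    (PSeq (block_of [:: ILoad 13 11; IAdd 16 6 13; ILoad 17 16])
    (PSeq (PIf 17 (block_of [::]) (block_of
             [:: IAdd 17 10 3; IStore 16 17; IAdd 17 5 9; IStore 17 13; IAdd 9 9 3]))
          (block_of [:: IAdd 11 11 3; ISub 14 12 11]))).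

Definition search : prog :=
  PWhile 15
    (PSeq (block_of [:: IAdd 10 5 8; ILoad 10 10; IAdd 11 4 10; IAdd 12 11 3;
                        ILoad 11 11; ILoad 12 12; ISub 14 12 11])
    (PSeq scan_neighbours
          (block_of [:: IAdd 8 8 3; ISub 15 9 8]))).

(** Truncated subtraction serves as comparison: register 13 is nonzero exactly when the new depth
    exceeds the record. Adding the zero register 14 copies a register. *)
Definition find_deepest : prog :=
  PWhile 15
    (PSeq (block_of [:: IAdd 10 5 8; ILoad 10 10; IAdd 11 6 10; ILoad 11 11; IAdd 12 7 10])
    (PSeq (PIf 11 (block_of [:: ISub 11 11 3; IAdd 11 7 11; ILoad 11 11; IAdd 11 11 3]) (block_of [::]))
    (PSeq (block_of [:: IStore 12 11; ISub 13 11 16])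
    (PSeq (PIf 13 (block_of [:: IAdd 16 11 14; IAdd 17 10 14]) (block_of [::]))
          (block_of [:: IAdd 8 8 3; ISub 15 1 8]))))).

(** Register 12 holds the parent entry read before the cell is zeroed; register 0 counts the newly
    marked vertices. *)
Definition climb : prog :=
  PWhile 12 (block_of [:: IStore 11 14; ISub 10 12 3; IAdd 0 0 3; IAdd 11 6 10; ILoad 12 11]).

Definition greedy_rounds : prog :=
  PWhile 2
    (PSeq (block_of [:: IConst 8 0; IConst 16 0; IAdd 17 18 8; IAdd 15 1 8])
    (PSeq find_deepest
    (PSeq (block_of [:: IAdd 10 17 14; IAdd 11 6 10; ILoad 12 11])
    (PSeq climb
          (block_of [:: ISub 2 2 3]))))).

(** The last list pointer, at address 3 + n, is the end of the input. The root's parent entry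
    receives 1, a nonzero dummy saying that v is reached. *)
Definition setup : prog :=
  block_of [:: IConst 3 1; IConst 4 0; ILoad 1 4; ILoad 2 3; IConst 4 2; ILoad 18 4;
               IConst 4 3; IAdd 5 4 1; ILoad 5 5; IAdd 6 5 1; IAdd 7 6 1; IStore 5 18;
               IAdd 11 6 18; IStore 11 3; IConst 9 1; IConst 15 1].

Definition steiner_prog : prog :=
  PSeq setup (PSeq search
    (PSeq (block_of [:: IConst 14 0; IAdd 16 6 18; IStore 16 14; ISub 2 2 3])
          greedy_rounds)).

(** * Correctness of the program *)

Section Machine.
Variables (T : finType) (G : graph T) (v : T) (k : nat) (vs : seq T) (nbr : T -> seq T).
Variables (b : nat) (start : T -> nat) (M0 : nat -> nat).
Local Notation V := (vertices G).
Local Notation n := (size vs).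
Local Notation id x := (index x vs).
Implicit Types (q : seq T) (A X S : {set T}) (x y z : T) (R M : nat -> nat).

Hypotheses (uvs : uniq vs) (vsV : vs =i V) (vV : v \in V).
Hypothesis nbrP : forall u, u \in V -> uniq (nbr u) /\ nbr u =i adj G u.
Hypothesis M0P : forall x, x \in V ->
  [/\ M0 (3 + id x) = start x, M0 (4 + id x) = start x + size (nbr x) &
      forall j, j < size (nbr x) -> M0 (start x + j) = id (nth v (nbr x) j)].
Hypothesis startP : forall x, x \in V -> start x + size (nbr x) <= b.
Hypothesis headerP : n + 4 <= b.

Lemma id_lt x : x \in V -> id x < n.
Proof. by rewrite index_mem vsV. Qed.

Lemma id_inj x y : x \in V -> y \in V -> id x = id y -> x = y.
Proof. by rewrite -!vsV => xV yV E; rewrite -(nth_index v xV) E nth_index. Qed.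

Lemma card_vertices : #|V| = n.
Proof. by rewrite -(card_uniqP uvs); apply: eq_card => x; rewrite vsV. Qed.

Definition frame R :=
  [/\ R 1 = n, R 3 = 1, R 4 = 3 & R 5 = b] /\
  [/\ R 6 = b + n, R 7 = b + n + n & R 18 = id v].

(* Memory from b on holds the order q, then one more than the parent of each
   vertex, then the depths; 0 stands for a vertex not reached during the search
   and for a marked vertex afterwards. *)
Definition order_mem q M := forall i, i < size q -> M (b + i) = id (nth v q i).

Definition search_mem q M :=
  [/\ forall a, a < b -> M a = M0 a, order_mem q M,
      M (b + n + id v) != 0 &
      forall x, x \in V -> x != v ->
        M (b + n + id x) = if x \in q then (id (parent G v q x)).+1 else 0].

Definition partial_order q :=
  [/\ uniq q, {subset q <= V}, 0 < size q, nth v q 0 = v &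
      forall i, 0 < i < size q -> has (adj G ^~ (nth v q i)) (take i q)].

(** The queue invariant: the first h vertices have been scanned, and the rest of q is the queue. *)
Definition closed_upto q h := forall i, i < h -> {subset nbr (nth v q i) <= q}.

Lemma partial_order_size q : partial_order q -> size q <= n.
Proof. by case=> uq qV _ _ _; apply: uniq_leq_size => // x /qV; rewrite vsV. Qed.

(** A listed vertex other than v already has a neighbour in q, so its first neighbour is settled
    when it is discovered. *)
Lemma parent_rcons q x y :
  partial_order q -> x \in q -> parent G v (rcons q y) x = parent G v q x.
Proof.
case=> uq qV q_gt0 q0 early xq; rewrite /parent; case: eqVneq => // xv.
have i0 : 0 < index x q < size q.
  rewrite index_mem xq andbT lt0n; apply: contraNneq xv => i0.
  by rewrite -q0 -i0 nth_index.
have := early _ i0; rewrite nth_index // => hasx.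
have hasq : has (adj G ^~ x) q.
  by rewrite -(cat_take_drop (index x q) q) has_cat hasx.
by rewrite /first_nbr -cats1 find_cat hasq nth_cat -has_find hasq.
Qed.

(** Since y is unlisted and the neighbours of the first h vertices are all listed, none of these is
    adjacent to y. The vertex at position h is therefore the first neighbour of y. *)
Lemma partial_order_rcons q h y :
  partial_order q -> closed_upto q h -> h < size q ->
  y \in nbr (nth v q h) -> y \notin q ->
  partial_order (rcons q y) /\ parent G v (rcons q y) y = nth v q h.
Proof.
move=> po cl hq yn yq; have [uq qV q_gt0 q0 early] := po.
have xV : nth v q h \in V by apply/qV/mem_nth.
have [_ nE] := nbrP xV; have xy : adj G (nth v q h) y by move: yn; rewrite nE.
have yv : y != v by apply: contraNneq yq => ->; rewrite -q0 mem_nth.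
split.
  split; rewrite ?rcons_uniq ?yq ?size_rcons ?nth_rcons ?q_gt0 //.
    by move=> z; rewrite mem_rcons inE => /predU1P[->|/qV//]; apply: adj_vertexr xy.
  move=> i; rewrite ltnS => /andP[i0]; rewrite leq_eqVlt => /orP[/eqP->|iq].
    rewrite nth_rcons ltnn eqxx -cats1 take_size_cat //.
    by apply/hasP; exists (nth v q h); rewrite ?mem_nth.
  by rewrite nth_rcons iq -cats1 takel_cat ?(ltnW iq) // early // i0.
rewrite /parent (negPf yv) /first_nbr.
have no_early : ~~ has (adj G ^~ y) (take h q).
  apply: contra yq => /hasP[z zt zy].
  have zi : index z q < h.
    by rewrite index_ltn.
  have zq := mem_take zt; apply: (cl _ zi); rewrite nth_index //.
  by have [_ ->] := nbrP (qV z zq).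
have -> : rcons q y = take h q ++ nth v q h :: rcons (drop h.+1 q) y.
  by rewrite -rcons_cons -drop_nth // -rcons_cat cat_take_drop.
rewrite find_cat (negPf no_early) /= xy addn0 size_takel ?(ltnW hq) //.
by rewrite nth_cat size_takel ?(ltnW hq) // ltnn subnn.
Qed.

Lemma search_mem_rcons q h y M :
  partial_order q -> closed_upto q h -> h < size q ->
  y \in nbr (nth v q h) -> y \notin q -> search_mem q M ->
  search_mem (rcons q y)
    (upd (upd M (b + n + id y) (id (nth v q h)).+1) (b + size q) (id y)).
Proof.
move=> po cl hq yn yq [inM qM vM pM].
have [po' py] := partial_order_rcons po cl hq yn yq.
have := partial_order_size po'; rewrite size_rcons => lt_qn.
have [_ qV q_gt0 q0 _] := po; have [_ qV' _ _ _] := po'.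
have yV : y \in V by apply: qV'; rewrite mem_rcons mem_head.
have yv : y != v by apply: contraNneq yq => ->; rewrite -q0 mem_nth.
have ltv := id_lt vV; have lty := id_lt yV.
split.
- by move=> a lta; rewrite !upd_neq ?inM //; lia.
- move=> i; rewrite size_rcons ltnS leq_eqVlt => /predU1P[->|iq].
    by rewrite upd_eq nth_rcons ltnn eqxx.
  by rewrite nth_rcons iq !upd_neq ?qM //; lia.
- rewrite upd_neq; last by lia.
  rewrite upd_neq // => E; move/eqP: yv; apply; apply: id_inj => //; lia.
move=> x xV xv; have ltx := id_lt xV; rewrite upd_neq; last by lia.
rewrite mem_rcons inE; have [->|xy] := eqVneq x y; first by rewrite upd_eq py.
rewrite upd_neq ?pM //=; last by move=> E; move/eqP: xy; apply; apply: id_inj => //; lia.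
by case: (boolP (x \in q)) => // xq; rewrite parent_rcons.
Qed.

(** * The breadth-first search *)

Definition search_frame R := [/\ frame R, R 0 = 0 & R 2 = k].

(** While neighbours are scanned, q grows but its prefix up to position h does not; p0 records this
    prefix, on which the remaining search cost depends. *)
Definition scan_inv h p0 B s c := exists R M q j,
  let x := nth v q h in
  [/\ s = State R M, search_frame R, partial_order q, search_mem q M & closed_upto q h] /\
  [/\ R 8 = h, R 9 = size q, R 10 = id x & h < size q] /\
  [/\ R 11 = start x + j, R 12 = start x + size (nbr x), R 14 = size (nbr x) - j &
      j <= size (nbr x)] /\
  [/\ {subset take j (nbr x) <= q}, take h.+1 q = p0 & B + 20 * (size (nbr x) - j) < c].

Lemma scan_neighbours_wp h p0 B s c :
  scan_inv h p0 B s c ->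
  wp scan_neighbours (fun s c => exists R M q,
    [/\ s = State R M, search_frame R, partial_order q, search_mem q M & closed_upto q h.+1] /\
    [/\ R 8 = h, R 9 = size q, h < size q, take h.+1 q = p0 & B <= c]) s c.
Proof.
move=> inv0; apply: (wp_while inv0) => {s c inv0} s c.
- by case=> R [M [q [j [_ [_ [_ [_ _ lt]]]]]]]; lia.
- case=> R [M [q [j [[-> [[[r1 r3 r4 r5] [r6 r7 r18]] r0 r2] po sm cl] [[r8 r9 r10 hq] [[r11 r12 r14 jle] [tq eq_p0 lt]]]]]]] /=.
  rewrite r14 => jlt; set x := nth v q h in r10 r11 r12 r14 jle tq lt jlt *.
  have xV : x \in V by have [_ qV _ _ _] := po; apply/qV/mem_nth.
  have [_ _ nbr_w] := M0P xV; have stx := startP xV.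
  have {}jlt : j < size (nbr x) by lia.
  pose y := nth v (nbr x) j.
  have yn : y \in nbr x by apply: mem_nth.
  have yV : y \in V by have [_ nE] := nbrP xV; move: yn; rewrite nE => /adj_vertexr.
  have [inM qM vM pM] := sm.
  have My : M (R 11) = id y by rewrite r11 inM ?nbr_w //; lia.
  have xy_tq : {subset take j.+1 (nbr x) <= y :: q}.
    move=> z; rewrite (take_nth v) // mem_rcons inE [z \in _ :: _]inE => /orP[->//|/tq->].
    by rewrite orbT.
  apply: wp_seq; apply: wp_block => /=; first by lia.
  (* The test for being listed reads the parent entry; for v the nonzero dummy answers. *)
  have Py : (M (R 6 + M (R 11)) == 0) = (y \notin q).
    rewrite My r6; have [->|yv] := eqVneq y v.
      by have [_ _ q_gt0 q0 _] := po; rewrite (negPf vM) -{1}q0 mem_nth.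
    by rewrite pM //; case: (y \in q).
  apply: wp_seq; apply: wp_if => /=; first by lia.
    rewrite {1}/upd /= Py negbK => yq; apply: wp_block => /=; first by lia.
    apply: wp_block => /=; first by lia.
    eexists; eexists; exists q, j.+1; rewrite -/x; split; [|split; [|split]].
    + by split; first reflexivity.
    + by rewrite /upd /=.
    + by rewrite /upd /= r3 r11 r12; split=> //; lia.
    + split=> //; last by lia.
      by move=> z /xy_tq; rewrite inE => /predU1P[->|].
  rewrite {1}/upd /= => /eqP; rewrite Py => yq.
  have sm' := search_mem_rcons po cl hq yn yq sm.
  have [po' _] := partial_order_rcons po cl hq yn yq.
  have nth_h i : i < size q -> nth v (rcons q y) i = nth v q i by move=> iq; rewrite nth_rcons iq.
  apply: wp_block => /=; first by lia.
  apply: wp_block => /=; first by lia.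
  eexists; eexists; exists (rcons q y), j.+1; rewrite nth_h // -/x size_rcons.
  split; [split; first reflexivity|split; [|split]].
  + by rewrite /search_frame /frame /upd /=.
  + by [].
  + move: sm'; congr (search_mem _ (upd (upd M _ _) _ _)); rewrite /upd /= -?My ?r5 ?r6 ?r9 ?r3 ?r10 -?/x //; lia.
  + move=> i ih z; rewrite nth_h ?(ltn_trans ih) // => /(cl i ih) zq.
    by rewrite mem_rcons inE zq orbT.
  + by rewrite /upd /= r9 r3 addn1; split=> //; lia.
  + by rewrite /upd /= r3 r11 r12; split=> //; lia.
  + split; last by lia.
      by move=> z /xy_tq; rewrite mem_rcons.
    by rewrite -cats1 takel_cat.
- case=> R [M [q [j [[-> fr po sm cl] [[r8 r9 r10 hq] [[r11 r12 r14 jle] [tq eq_p0 lt]]]]]]] /=.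
  rewrite r14 => j0; exists R, M, q; split; split=> //; last by lia.
  move=> i; rewrite ltnS leq_eqVlt => /predU1P[->|/cl//] z zn.
  by apply: tq; rewrite take_oversize //; lia.
Qed.

Hypothesis cG : connected G.

(** The sum runs over all vertices outside the scanned prefix, not just those in the queue, so
    discovering a vertex leaves it unchanged. *)
Definition search_cost (p : seq T) := \sum_(x in V | x \notin p) (30 + 20 * size (nbr x)).

Lemma search_cost_take q h :
  partial_order q -> h < size q ->
  search_cost (take h q) =
    30 + 20 * size (nbr (nth v q h)) + search_cost (take h.+1 q).
Proof.
case=> uq qV _ _ _ hq; rewrite /search_cost (bigD1 (nth v q h)) /=.
  congr (_ + _); apply: eq_bigl => x.
  by rewrite (take_nth v) // mem_rcons inE negb_or [(x != _) && _]andbC andbA.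
rewrite qV ?mem_nth //=; apply/negP=> /index_ltn.
by rewrite index_uniq // ltnn.
Qed.

(** Once the queue is empty, no edge leaves the listed vertices, so connectedness forces all
    vertices to be listed. *)
Lemma closed_partial_order q :
  partial_order q -> closed_upto q (size q) -> search_order G v q.
Proof.
case=> uq qV q_gt0 q0 early cl; split=> // x; apply/idP/idP=> [/qV//|xV].
have /andP[_ /forall_inP/(_ v vV)/forall_inP/(_ x xV) vx] := cG.
apply/negPn/negP=> xq.
have vq : v \in [set z in q] by rewrite inE -{1}q0 mem_nth.
have xq' : x \notin [set z in q] by rewrite inE.
have [y [z []]] := connect_crossing vx vq xq'; rewrite !inE => yq /negP zq yz; apply: zq.
have := cl (index y q); rewrite index_mem nth_index // => /(_ yq); apply.
by have [_ ->] := nbrP (qV y yq).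
Qed.

Definition search_inv B s c := exists R M q h,
  [/\ s = State R M, search_frame R, partial_order q, search_mem q M & closed_upto q h] /\
  [/\ R 8 = h, R 9 = size q, R 15 = size q - h, h <= size q &
      B + search_cost (take h q) < c].

Lemma search_wp B s c :
  search_inv B s c ->
  wp search (fun s c => exists R M q,
    [/\ s = State R M, search_frame R, search_order G v q, search_mem q M & B <= c]) s c.
Proof.
move=> inv0; apply: (wp_while inv0) => {s c inv0} s c.
- by case=> R [M [q [h [_ [_ _ _ _ lt]]]]]; lia.
- case=> R [M [q [h [[-> fr po sm cl] [r8 r9 r15 hle lt]]]]] /=.
  rewrite r15 => hlt; have {}hlt : h < size q by lia.
  have [[[r1 r3 r4 r5] [r6 r7 r18]] r0 r2] := fr.
  rewrite search_cost_take // in lt; set x := nth v q h in lt.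
  have xV : x \in V by have [_ qV _ _ _] := po; apply/qV/mem_nth.
  have [ptr1 ptr2 _] := M0P xV; have idx := id_lt xV.
  have [inM qM _ _] := sm.
  have Mx : M (R 5 + R 8) = id x by rewrite r5 r8 qM.
  have Mp : M (R 4 + M (R 5 + R 8)) = start x by rewrite Mx r4 inM //; lia.
  have Mp' : M (R 4 + M (R 5 + R 8) + R 3) = start x + size (nbr x).
    by rewrite Mx r4 r3 -ptr2 inM; [congr M0|]; lia.
  apply: wp_seq; apply: wp_block => /=; first by lia.
  apply: wp_seq.
  have inv : scan_inv h (take h.+1 q) (B + search_cost (take h.+1 q) + 5)
      (foldl (fun s i => step i s) (State R M)
        [:: IAdd 10 5 8; ILoad 10 10; IAdd 11 4 10; IAdd 12 11 3;
            ILoad 11 11; ILoad 12 12; ISub 14 12 11]) (c.-1 - 7).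
    do 2!eexists; exists q, 0; rewrite -/x; split; [|split; [|split]].
    + by split; first reflexivity.
    + by rewrite /upd /= Mx.
    + by rewrite /upd /= Mp Mp' addn0 addKn subn0.
    + by split=> //; [rewrite take0|lia].
  apply: wp_conseq (scan_neighbours_wp inv) _ => s' c'.
  case=> R' [M' [q' [[-> fr' po' sm' cl'] [r8' r9' hq' eq_take le]]]].
  have [[[_ r3' _ _] _] _ _] := fr'.
  apply: wp_block => /=; first by lia.
  do 2!eexists; exists q', h.+1; split.
    by split; first reflexivity.
  by rewrite /upd /= r8' r9' r3' addn1 eq_take; split=> //; lia.
case=> R [M [q [h [[-> fr po sm cl] [r8 r9 r15 hle lt]]]]] /=.
rewrite r15 => h_end; have eh : h = size q by lia.
exists R, M, q; split=> //; last by lia.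
by apply: closed_partial_order => //; rewrite -eh.
Qed.

(** * The greedy rounds *)

Section Rounds.
Variables (q : seq T) (so : search_order G v q).
Local Notation par := (parent G v q).
Local Notation U := (ancestors G v q).

Lemma size_order : size q = n.
Proof.
by have [uq qV _ _] := so; rewrite -card_vertices -(card_uniqP uq); apply: eq_card => x; rewrite qV.
Qed.

Lemma order_vertex i : i < n -> nth v q i \in V.
Proof. by have [_ <- _ _] := so => ltn; rewrite mem_nth // size_order. Qed.

Definition greedy_mem A M := order_mem q M /\
  forall x, x \in V -> M (b + n + id x) = if x \in A then 0 else (id (par x)).+1.

Definition closed_set A := [/\ v \in A, A \subset V & {in A, forall x, U x \subset A}].

(** The recursion by which [find_deepest] computes depths; it relies on A being closed under
    ancestors. *)
Lemma ancestors_setD A x : closed_set A -> x \in V ->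
  #|U x :\: A| = if x \in A then 0 else #|U (par x) :\: A|.+1.
Proof.
case=> vA AV clA xV; case: ifPn => [/clA|] xA.
  by apply/eqP; rewrite cards_eq0 setD_eq0.
have xv : x != v by apply: contraNneq xA => ->.
rewrite (ancestors_step G v q x) setDUl.
have -> : [set x] :\: A = [set x].
  by apply/setDidPl; rewrite disjoints1.
by rewrite cardsU1 in_setD (negPf (notin_ancestors_parent so xV xv)) andbF.
Qed.

Definition greedy_frame j a R := [/\ frame R, R 14 = 0, R 2 = j & R 0 = a].

Definition find_inv j a A B s c := exists R M i z,
  [/\ s = State R M, greedy_frame j a R & greedy_mem A M] /\
  [/\ R 8 = i, R 15 = n - i, i <= n & B + 30 * (n - i) < c] /\
  [/\ R 16 = #|U z :\: A|, R 17 = id z, z \in V,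
      {in take i q, forall x, M (b + n + n + id x) = #|U x :\: A|} &
      {in take i q, forall x, #|U x :\: A| <= #|U z :\: A|}].

Lemma find_deepest_wp j a A B s c :
  closed_set A -> find_inv j a A B s c ->
  wp find_deepest (fun s c => exists R M z,
    [/\ s = State R M, greedy_frame j a R & greedy_mem A M] /\
    [/\ R 17 = id z, z \in V, {in V, forall x, #|U x :\: A| <= #|U z :\: A|} & B <= c]) s c.
Proof.
move=> clA inv0; apply: (wp_while inv0) => {s c inv0} s c.
- by case=> R [M [i [z [_ [[_ _ _ lt] _]]]]]; lia.
- case=> R [M [i [z [[-> gf gm] [[r8 r15 ile lt] [r16 r17 zV dM maxz]]]]]] /=.
  rewrite r15 => ilt; have {}ilt : i < n by lia.
  have [qM pM] := gm; have [[[r1 r3 r4 r5] [r6 r7 r18]] r14 r2 r0] := gf.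
  have c20 : 20 < c by clear -lt ilt; lia.
  set x := nth v q i; have xV : x \in V := order_vertex ilt.
  have Mx : M (R 5 + R 8) = id x by rewrite r5 r8 qM // size_order.
  have ux := ancestors_setD clA xV; have px := pM x xV.
  have [uq qV q0 _] := so.
  have ltx := id_lt xV.
  apply: wp_seq; apply: wp_block => /=; first by lia.
  pose mid s c := exists R', [/\ s = State R' M, greedy_frame j a R' & [/\ R' 8 = i, R' 16 = R 16 & R' 17 = R 17]] /\
    [/\ R' 10 = id x, R' 11 = #|U x :\: A|, R' 12 = b + n + n + id x &
        B + 30 * (n - i) < c + 15].
  apply: (wp_seq_mid (Qmid := mid)).
    apply: wp_if => /=; first by lia.
      move=> nz; rewrite /upd /= Mx r6 px in nz; case: ifP nz => // xA _.
      have xv : x != v by apply: contraFneq xA => ->; have [] := clA.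
      have [/adj_vertexl pV ltp _] := parentP so xV xv.
      (* The parent precedes x in the order, so its depth has already been stored in this round. *)
      have pt : par x \in take i q.
        rewrite in_take ?qV //.
        by move: ltp; rewrite /x index_uniq // size_order.
      apply: wp_block => /=; first by clear -c20; lia.
      eexists; split; first by split; first reflexivity.
      rewrite /upd /= ?Mx ?r6 ?px ?xA r3 r7 ux xA subn1 /= addn1 dM //.
      by split=> //; clear -lt c20; lia.
    move=> nz; rewrite /upd /= Mx r6 px in nz; case: ifP nz => // xA _.
    apply: wp_block => /=; first by clear -c20; lia.
    eexists; split; first by split; first reflexivity.
    by rewrite /upd /= ?Mx ?r6 ?px ?xA r7 ux xA; split=> //; clear -lt c20; lia.
  move=> s1 c1 [R' [[-> gf' [r8' r16' r17']] [r10' r11' r12' lt']]].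
  have [[[r1' r3' r4' r5'] [r6' r7' r18']] r14' r2' r0'] := gf'.
  apply: wp_seq; apply: wp_block => /=; first by lia.
  pose M' := upd M (R' 12) (R' 11).
  have gm' : greedy_mem A M'.
    split=> [i' lti'|x' x'V]; rewrite /M' r12' upd_neq ?qM ?pM //.
      by move: lti'; rewrite size_order; lia.
    by have := id_lt x'V; lia.
  have take_i y : y \in take i.+1 q -> y = x \/ y \in take i q.
    by rewrite (take_nth v) ?size_order // mem_rcons inE => /predU1P.
  have dM' : {in take i.+1 q, forall y, M' (b + n + n + id y) = #|U y :\: A|}.
    move=> y yt; rewrite /M' r12'; have [->|yx] := eqVneq y x; first by rewrite upd_eq.
    have yV : y \in V by rewrite -qV (mem_take yt).
    rewrite upd_neq; last by move=> E; move/eqP: yx; apply; apply: id_inj => //; lia.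
    by apply: dM; case: (take_i y yt) => // eyx; rewrite eyx eqxx in yx.
  apply: (wp_seq_mid (Qmid := fun s c => exists R'' z,
     [/\ s = State R'' M', greedy_frame j a R'', R'' 8 = i & B + 30 * (n - i) < c + 25] /\
     [/\ R'' 16 = #|U z :\: A|, R'' 17 = id z, z \in V &
      {in take i.+1 q, forall x, #|U x :\: A| <= #|U z :\: A|}])).
    apply: wp_if => /=; first by lia.
      rewrite {1}/upd /= => better; rewrite r11' r16' r16 in better.
      apply: wp_block => /=; first by lia.
      eexists; exists x; split; first by split; [reflexivity| | |lia].
      rewrite /upd /= r14' r10' r11' !addn0; split=> // y /take_i [-> //|/maxz le].
      by apply: leq_trans le _; lia.
    rewrite {1}/upd /= => worse; rewrite r11' r16' r16 in worse.
    apply: wp_block => /=; first by lia.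
    eexists; exists z; split; first by split; [reflexivity| | |lia].
    by rewrite /upd /= r16' r17'; split=> // y /take_i [->|/maxz //]; lia.
  move=> s2 c2 [R2 [z2 [[-> gf2 r8_2 lt2] [r16_2 r17_2 z2V max2]]]].
  have [[[r1_2 r3_2 _ _] _] _ _ _] := gf2.
  apply: wp_block => /=; first by lia.
  do 2!eexists; exists i.+1, z2; split; [|split].
  + by split; first reflexivity.
  + by rewrite /upd /= r8_2 r3_2 r1_2 addn1; split=> //; lia.
  + by [].
case=> R [M [i [z [[-> gf gm] [[r8 r15 ile lt] [r16 r17 zV dM maxz]]]]]] /=.
rewrite r15 => i_end; have ei : i = n by lia.
exists R, M, z; split=> //; split=> //; last by lia.
move=> x xV; apply: maxz; rewrite ei -size_order take_size.
by have [_ ->] := so.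
Qed.

(** The part of the chain from z strictly below y is marked. The credits fall with the number of
    unmarked vertices, which lets the climbs of all rounds draw on one budget. *)
Definition climb_inv j A z B s c := exists R M A' y,
  [/\ s = State R M, greedy_frame j #|A'|.-1 R & greedy_mem A' M] /\
  [/\ y \in V, y \in U z, A' = A :|: (U z :\: U y) & B + 10 * (n - #|A'|) < c] /\
  [/\ R 11 = b + n + id y & R 12 = M (b + n + id y)].

Lemma climb_wp j A z B s c :
  closed_set A -> z \in V -> climb_inv j A z B s c ->
  wp climb (fun s c => exists R M,
    [/\ s = State R M, greedy_frame j #|A :|: U z|.-1 R, greedy_mem (A :|: U z) M &
        B + 10 * (n - #|A :|: U z|) <= c]) s c.
Proof.
move=> [vA AV clA] zV inv0; apply: (wp_while inv0) => {s c inv0} s c.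
- by case=> R [M [A' [y [_ [[_ _ _ lt] _]]]]]; lia.
- case=> R [M [A' [y [[-> gf gm] [[yV yz eA' lt] [r11 r12]]]]]] /=.
  have [qM pM] := gm; have [[[r1 r3 r4 r5] [r6 r7 r18]] r14 r2 r0] := gf.
  rewrite r12 pM //; case: ifP => // yA' _.
  have vA' : v \in A' by rewrite eA' inE vA.
  have yv : y != v by apply: contraFneq yA' => ->.
  have [/adj_vertexl pV _ _] := parentP so yV yv.
  have A'V : A' \subset V.
    by rewrite eA' subUset AV (subset_trans (subsetDl _ _)) // ancestors_sub.
  have card' : #|y |: A'| = #|A'|.+1 by rewrite cardsU1 yA'.
  have cA : 0 < #|A'| by apply/card_gt0P; exists v.
  have cn : #|y |: A'| <= n.
    by rewrite -card_vertices subset_leq_card // subUset sub1set yV.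
  have lty := id_lt yV; have ltp := id_lt pV.
  have c10 : B + 10 * (n - #|y |: A'|) + 10 < c by clear -lt cn card'; lia.
  have eqA : #|A'|.-1 + 1 = #|y |: A'|.-1 by clear -card' cA; lia.
  apply: wp_block => /=; first by clear -c10; lia.
  do 2!eexists; exists (y |: A'), (par y); split; [|split].
  + split; first reflexivity.
      by rewrite /greedy_frame /frame /upd /= -eqA r0 r3.
    split=> [i lti|x xV]; rewrite r11.
      by rewrite upd_neq ?qM //; move: lti; rewrite size_order; clear; lia.
    rewrite in_setU1; have [->|xy] := eqVneq x y; first by rewrite upd_eq r14.
    rewrite upd_neq ?pM // => E; move/eqP: xy; apply; apply: id_inj => //.
    by clear -E; lia.
  + split=> //; last by clear -c10; lia.
      apply: (subsetP (ancestors_trans yz)); rewrite ancestors_step in_setU1.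
      by rewrite ancestors_refl orbT.
    rewrite eA' (ancestors_step G v q y); apply/setP=> x.
    rewrite !(in_setU1, in_setU, in_setD) negb_or.
    have [->|xy] //= := eqVneq x y.
    by rewrite yz (notin_ancestors_parent so yV yv) orbT.
  + have addr : R 6 + (R 12 - R 3) = b + n + id (par y).
      by rewrite r12 pM // yA' r3 r6 subn1.
    by split; rewrite -addr.
case=> R [M [A' [y [[-> gf gm] [[yV yz eA' lt] [r11 r12]]]]]] /=.
have [qM pM] := gm; rewrite r12 pM //; case: ifP => // yA' _.
(* The climb has not yet marked y, so y was marked before it began; closedness of A then covers the
   rest of the chain. *)
have yA : y \in A.
  by move: yA'; rewrite eA' in_setU in_setD ancestors_refl orbF.
have -> : A :|: U z = A'.
  rewrite eA'; apply/setP=> x; rewrite !(in_setU, in_setD).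
  case: (boolP (x \in U y)) => // /(subsetP (clA y yA)) ->.
  by [].
by exists R, M; split=> //; lia.
Qed.

(** Optimality is kept as a promise: every competitor S is matched by the present marks together
    with some j vertices or fewer, where j rounds remain. At j = 0 nothing is left to add, and the
    marks themselves are optimal. *)
Definition rounds_inv K B s c := exists R M A X j,
  [/\ s = State R M, greedy_frame j #|A|.-1 R & greedy_mem A M] /\
  [/\ X \subset V, #|X| + j <= K, A = v |: hull U X &
      forall S, S \subset V -> #|S| <= K -> exists S', [/\ S' \subset V, #|S'| <= j &
        #|hull U S :\ v| <= #|A|.-1 + #|hull U S' :\: A|]] /\
  B + j * (30 * n + 60) + 10 * (n - #|A|) < c.

Lemma hull_closed X : X \subset V -> closed_set (v |: hull U X).
Proof.
move=> XV; split; first exact: setU11.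
  by rewrite subUset sub1set vV hull_sub.
move=> x /setU1P[->|xX]; first by rewrite ancestors_root sub1set setU11.
exact: subset_trans (hull_ancestors xX) (subsetUr _ _).
Qed.

Lemma greedy_rounds_wp K B s c :
  rounds_inv K B s c ->
  wp greedy_rounds (fun s c => exists R M A X,
    [/\ s = State R M, R 0 = #|A|.-1 & B <= c] /\
    [/\ X \subset V, #|X| <= K, A = v |: hull U X &
      forall S, S \subset V -> #|S| <= K -> #|hull U S :\ v| <= #|A|.-1]) s c.
Proof.
move=> inv0; apply: (wp_while inv0) => {s c inv0} s c.
- by case=> R [M [A [X [j [_ [_ lt]]]]]]; clear -lt; lia.
- case=> R [M [A [X [[|j] [[-> gf gm] [[XV cX eA ub] lt]]]]]] /=.
    by case: gf => _ _ ->.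
  move=> _; have clA : closed_set A by rewrite eA; apply: hull_closed.
  have [[[r1 r3 r4 r5] [r6 r7 r18]] r14 r2 r0] := gf.
  rewrite mulSn in lt; set D := j * _ in lt.
  apply: wp_seq; apply: wp_block => /=; first by clear -lt; lia.
  pose B1 := B + D + 10 * (n - #|A|) + 40.
  apply: (wp_seq_mid (Qmid := fun s c => exists R M z,
    [/\ s = State R M, greedy_frame j.+1 #|A|.-1 R & greedy_mem A M] /\
    [/\ R 17 = id z, z \in V, {in V, forall x, #|U x :\: A| <= #|U z :\: A|} & B1 <= c])).
    apply: find_deepest_wp => //; do 2!eexists; exists 0, v; split; [|split].
    + by split; first reflexivity.
    + rewrite /upd /= r1 addn0 subn0; split=> //.
      by rewrite /B1; clear -lt; lia.
    (* The record starts at v with value 0, which is its true depth because v is marked. *)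
    + rewrite /upd /= addn0 r18 take0; split=> //.
      by case: clA => vA _ /(_ v vA); rewrite -setD_eq0 => /eqP->; rewrite cards0.
  move=> s1 c1 [R1 [M1 [z [[-> gf1 gm1] [r17 zV maxz lt1]]]]].
  have [[[q1 q3 q4 q5] [q6 q7 q18]] q14 q2 q0] := gf1.
  apply: wp_seq; apply: wp_block => /=; first by rewrite /B1 in lt1; clear -lt1; lia.
  apply: (wp_seq_mid (Qmid := fun s c => exists R M,
    [/\ s = State R M, greedy_frame j.+1 #|A :|: U z|.-1 R, greedy_mem (A :|: U z) M &
        B + D + 20 + 10 * (n - #|A :|: U z|) <= c])).
    apply: climb_wp => //; do 2!eexists; exists A, z; split; [|split].
    + by split; first reflexivity.
    + split=> //; [exact: ancestors_refl|by rewrite setDv setU0|].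
      by rewrite /B1 in lt1; clear -lt1; lia.
    + by rewrite /upd /= q14 q6 r17 addn0.
  move=> s2 c2 [R2 [M2 [-> gf2 gm2 lt2]]].
  have [[[_ p3 _ _] _] p14 p2 p0] := gf2.
  apply: wp_block => /=; first by clear -lt2; lia.
  do 2!eexists; exists (A :|: U z), (z |: X), j; split; [|split].
  + split; [reflexivity| |exact: gm2].
    by case: gf2 => fr2 _ _ _; split=> //; rewrite /upd /= p2 p3 subn1.
  + split=> [|||S SV cS].
    * by rewrite subUset sub1set zV.
    * by rewrite cardsU1; case: (z \notin X) cX => /=; lia.
    * by rewrite eA /hull bigcup_setU big_set1 setUAC setUA.
    have [S' [S'V cS' le1]] := ub S SV cS.
    have maxS' : {in S', forall x, #|U x :\: A| <= #|U z :\: A|}.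
      by move=> x xS; apply: maxz; apply: (subsetP S'V).
    (* The deepest vertex z replaces one member of the competitor's remaining set. *)
    have [S'' [sub cS'' le2]] :=
      greedy_exchange (U := U) (ancestors_nested G v q z) maxS' cS'.
    exists S''; split=> //; first exact: subset_trans sub S'V.
    have A0 : 0 < #|A| by apply/card_gt0P; exists v; case: clA.
    have cU : #|A :|: U z| = #|A| + #|U z :\: A|.
      by rewrite cardsU cardsD setIC addnBA // subset_leq_card // subsetIl.
    by rewrite cU; clear -le1 le2 A0; lia.
  by clear -lt2; rewrite -/D; lia.
case=> R [M [A [X [j [[-> gf gm] [[XV cX eA ub] lt]]]]]] /= r2_0.
have [_ _ r2 r0] := gf; have j0 : j = 0 by rewrite -r2.
exists R, M, A, X; split; first by split=> //; clear -lt; lia.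
split=> //; first by move: cX; rewrite j0 addn0.
move=> S SV cS; have [S' [_]] := ub S SV cS; rewrite j0 leqn0 cards_eq0 => /eqP->.
by rewrite /hull big_set0 set0D cards0 addn0.
Qed.

End Rounds.

(** * The whole program *)

Hypothesis bG : block_graph G.
Hypotheses (k_gt0 : 0 < k) (k_le : k <= n).
Hypotheses (M0n : M0 0 = n) (M0k : M0 1 = k) (M0v : M0 2 = id v) (M0b : M0 (3 + n) = b).
Hypothesis M0_free : forall a, b <= a -> M0 a = 0.

Lemma steiner_prog_wp c :
  50 + search_cost [::] + k * (30 * n + 60) + 10 * n <= c ->
  wp steiner_prog (fun s _ => output s = steiner_ecc k v G) (State (fun=> 0) M0) c.
Proof.
move=> le_c; have ltv := id_lt vV.
(* Only k - 1 of the k shares are reserved for rounds. The product is made opaque so that the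
   arithmetic goals become linear. *)
pose D := k.-1 * (30 * n + 60).
have eD : k * (30 * n + 60) = D + (30 * n + 60).
  by rewrite /D -{1}(prednK k_gt0) mulSn addnC.
have defD : k.-1 * (30 * n + 60) = D by [].
rewrite eD in le_c; clearbody D.
apply: wp_seq; apply: wp_block => /=; first by clear -le_c; lia.
pose B1 := D + 10 * n + 20.
apply: (wp_seq_mid (Qmid := fun s c => exists R M q,
    [/\ s = State R M, search_frame R, search_order G v q, search_mem q M & B1 <= c])).
  apply: search_wp; do 2!eexists; exists [:: v], 0; split; [split; first reflexivity|].
  + by rewrite /search_frame /frame /upd /= M0n M0k M0v M0b.
  + by split=> // [x|[|i]]; rewrite ?inE // => /eqP->.
  + pose M1 := upd (upd M0 b (id v)) (b + n + id v) 1.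
    have sm : search_mem [:: v] M1.
      rewrite /M1; split.
      * by move=> a lta; rewrite !upd_neq //; clear -lta ltv; lia.
      * case=> // _; rewrite addn0 /= upd_neq ?upd_eq //; clear -ltv; lia.
      * by rewrite upd_eq.
      move=> x xV xv; rewrite mem_seq1 (negPf xv) !upd_neq ?M0_free //.
      - by clear; lia.
      - by have := id_lt xV; clear; lia.
      by move=> E; move/eqP: xv; apply; apply: id_inj => //; clear -E; lia.
    move: sm; rewrite /M1; congr (search_mem _ (upd (upd _ _ _) _ _));
      by rewrite /upd /= ?M0n ?M0v ?M0b.
  + by [].
  + split=> //.
    by rewrite take0 /B1; clear -le_c; lia.
move=> s1 c1 [R [M [q [-> fr so sm le_c1]]]].
have [fr1 r0 r2] := fr; have [[r1 r3 r4 r5] [r6 r7 r18]] := fr1.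
have [inM qM vM pM] := sm; have sq := size_order so.
apply: wp_seq; apply: wp_block => /=; first by rewrite /B1 in le_c1; clear -le_c1; lia.
apply: wp_conseq (greedy_rounds_wp (q := q) so (K := k.-1) (B := 0) _) _.
  do 2!eexists; exists [set v], set0, k.-1; split; [split; first reflexivity|split].
  + by rewrite /greedy_frame /frame /upd /= cards1 r2 r3 subn1.
  (* This write zeroes the root's parent entry, which turns the dummy of the search into the mark of
     v; the marked set starts as v alone. *)
  + have -> : upd (upd R 14 0) 16 (upd R 14 0 6 + upd R 14 0 18) 16 = b + n + id v.
      by rewrite /upd /= r6 r18.
    have -> : upd (upd R 14 0) 16 (upd R 14 0 6 + upd R 14 0 18) 14 = 0 by [].
    split=> [i lti|x xV].
      by rewrite upd_neq ?qM //; move: lti; rewrite sq; clear; lia.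
    rewrite inE; have [->|xv] := eqVneq x v; first by rewrite upd_eq.
    rewrite upd_neq; last first.
      by move=> E; move/eqP: xv; apply; apply: id_inj => //; clear -E; lia.
    by rewrite pM //; have [_ -> _ _] := so; rewrite xV.
  + rewrite sub0set cards0 /hull big_set0 setU0; split=> // S SV cS.
    by exists S; rewrite cards1.
  by rewrite cards1 defD; rewrite /B1 in le_c1; clear -le_c1; lia.
move=> s2 c2 [R' [M' [A [X [[-> r0' _] [XV cX eA ub]]]]]]; rewrite /output /= r0'.
have vA : v \in A by rewrite eA setU11.
have cA : #|A| = #|A|.-1.+1 by rewrite prednK //; apply/card_gt0P; exists v.
rewrite -{1}(prednK k_gt0); symmetry; apply: (steiner_ecc_hull so vV bG) => //.
  by rewrite /nvertices card_vertices prednK.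
by exists X; rewrite -eA.
Qed.

End Machine.

(** * The input word *)

Section Encoding.
Variables (T : finType) (vs : seq T) (nbr : T -> seq T) (v : T) (k : nat).
Local Notation n := (size vs).
Local Notation id x := (index x vs).
Local Notation lists := [seq [seq index w vs | w <- nbr u] | u <- vs].
Local Notation word := (encode vs nbr v k).

Definition list_start x := n + 4 + sumn (take (id x) (shape lists)).

Lemma nth_encode_tail i : nth 0 word (3 + i) =
  nth 0 ([seq n + 4 + sumn (take j (shape lists)) | j <- iota 0 n.+1] ++ flatten lists) i.
Proof. by []. Qed.

Lemma nth_encode_header i : i <= n ->
  nth 0 word (3 + i) = n + 4 + sumn (take i (shape lists)).
Proof.
by move=> le_in; rewrite nth_encode_tail nth_cat size_map size_iota ltnS le_in (nth_map 0) ?size_iota // nth_iota.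
Qed.

Lemma nth_encode_lists i : nth 0 word (n + 4 + i) = nth 0 (flatten lists) i.
Proof.
have -> : n + 4 + i = 3 + (n.+1 + i) by lia.
by rewrite nth_encode_tail nth_cat size_map size_iota ltnNge leq_addr addKn.
Qed.

Lemma size_encode : size word = n + 4 + sumn (shape lists).
Proof. by rewrite /encode !size_cat size_map size_iota size_flatten /=; lia. Qed.

Lemma nth_shape x : x \in vs -> nth 0 (shape lists) (id x) = size (nbr x).
Proof.
move=> xvs; have ltx : id x < n by rewrite index_mem.
by rewrite !(nth_map [::]) ?size_map // (nth_map v) // nth_index // size_map.
Qed.

Lemma list_end x : x \in vs ->
  list_start x + size (nbr x) = n + 4 + sumn (take (id x).+1 (shape lists)).
Proof.
move=> xvs; have ltx : id x < n by rewrite index_mem.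
by rewrite (take_nth 0) ?size_map // sumn_rcons nth_shape // /list_start addnA.
Qed.

Lemma list_end_le x : x \in vs -> list_start x + size (nbr x) <= size word.
Proof.
move=> xvs; rewrite list_end // size_encode leq_add2l.
by rewrite -{2}(cat_take_drop (id x).+1 (shape lists)) sumn_cat leq_addr.
Qed.

Lemma encode_list x : x \in vs ->
  [/\ nth 0 word (3 + id x) = list_start x,
      nth 0 word (4 + id x) = list_start x + size (nbr x) &
      forall j, j < size (nbr x) ->
        nth 0 word (list_start x + j) = id (nth v (nbr x) j)].
Proof.
move=> xvs; have ltx : id x < n by rewrite index_mem.
split; first by rewrite nth_encode_header // ltnW.
  by rewrite list_end // -nth_encode_header // -addSnnS.
move=> j ltj; have ltj' : j < nth 0 (shape lists) (id x) by rewrite nth_shape.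
rewrite /list_start -addnA nth_encode_lists.
(* The offset of an entry in the concatenation is folded into [flatten_index], which can be inverted
   to the list number and the position in it. *)
rewrite -/(flatten_index (shape lists) (id x) j) nth_flatten.
rewrite flatten_indexKl // flatten_indexKr //.
by rewrite (nth_map v) // nth_index // (nth_map v).
Qed.

End Encoding.

Theorem theorem2p3 :
  exists (p : prog) (C : nat),
    forall (T : finType) (G : graph T) (v : T) (k : nat)
           (vs : seq T) (nbr : T -> seq T),
      connected G -> block_graph G -> v \in vertices G ->
      3 <= k -> k <= nvertices G ->
      adjacency_lists G vs nbr ->
      exists (s : state) (t : nat),
        [/\ exec p (init (encode vs nbr v k)) s t,
            output s = steiner_ecc k v G &
            t <= C * (k * (nvertices G + nedges G))].
Proof.
exists steiner_prog, 100 => T G v k vs nbr cG bG vV k3 kn [uvs vsV nbrP].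
have nV : nvertices G = size vs by apply: card_vertices uvs vsV.
set c := 100 * _.
have inV x : x \in vertices G -> x \in vs by rewrite vsV.
have cost_le : 50 + search_cost G nbr [::] + k * (30 * size vs + 60) + 10 * size vs <= c.
  have -> : search_cost G nbr [::] = 30 * size vs + 40 * nedges G.
    rewrite /search_cost (eq_bigl [in vertices G]); last by move=> x; rewrite andbT.
    rewrite big_split /= sum_nat_const -big_distrr /= (sum_degrees nbrP).
    by rewrite -/(nvertices G) nV; lia.
  rewrite /c nV in kn *.
  (* [le1] absorbs the search cost and the shared climbing budget, which are free of k; [le2]
     absorbs the fixed overhead per round and, as k is at least 3, the additive constant. *)
  have le1 : 3 * (size vs + nedges G) <= k * (size vs + nedges G) by rewrite leq_mul2r k3 orbT.
  have le2 : k * 3 <= k * size vs by rewrite leq_mul2l (leq_trans k3 kn) orbT.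
  move: le1 le2; rewrite !mulnDr; clear -k3 kn; lia.
set word := encode vs nbr v k.
have wordP x : x \in vertices G -> [/\ nth 0 word (3 + index x vs) = list_start vs nbr x,
    nth 0 word (4 + index x vs) = list_start vs nbr x + size (nbr x) &
    forall j, j < size (nbr x) ->
      nth 0 word (list_start vs nbr x + j) = index (nth v (nbr x) j) vs].
  by move=> /inV; apply: encode_list.
have word_le x : x \in vertices G -> list_start vs nbr x + size (nbr x) <= size word.
  by move=> /inV; apply: list_end_le.
have word_size : size vs + 4 <= size word by rewrite size_encode leq_addr.
have word_end : nth 0 word (3 + size vs) = size word.
  by rewrite nth_encode_header // size_encode take_oversize // size_map size_map.
have k0 : 0 < k by apply: ltn_trans k3.
have k_le : k <= size vs by rewrite -nV.
have [s [t [E tc out]]] := steiner_prog_wp uvs vsV vV nbrP wordP word_le word_size cG bG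
  k0 k_le (erefl _) (erefl _) (erefl _) word_end (nth_default 0 (s := word)) cost_le.
by exists s, t.
Qed.
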